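(* Let $\{\mathbf e_\rho,\mathbf e_\theta,\mathbf e_z\}$ be the cylindrical orthonormal basis fields on $\mathbb{R}^3$ minus the $z$-axis. Let $\Omega\subset\mathbb{R}^3$ be a bounded (torus-shaped) domain with Lipschitz boundary, let $U\subset\mathbb{R}^3$ be an open set not meeting the $z$-axis with $\overline\Omega\subset U$, and let $\mathbf b\in C^1(U;\mathbb{R}^3)$ satisfy $\|\mathbf b(x)\|=1$ and $\mathbf b(x)\cdot\mathbf e_\theta(x)>0$ for all $x\in U$. Then $\mathbf b$ can be completed to an orthonormal Lipschitz frame on $\Omega$, i.e. there exist $\mathbf b_1,\mathbf b_2,\mathbf b_3\in\mathrm{Lip}(\Omega)^3$ with $\mathbf b_1=\mathbf b$ on $\Omega$ and $\mathbf b_1(x),\mathbf b_2(x),\mathbf b_3(x)$ an orthonormal basis of $\mathbb{R}^3$ for each $x\in\Omega$, such that $\mathbf b_3$ can be extended to a vector field in $C^1(\mathbb{R}^3;\mathbb{R}^3)$ which has bounded differential and is globally directed.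
   Context: A vector field $\mathbf V:\mathbb{R}^3\to\mathbb{R}^3$ is globally directed if there exist $w\in\mathbb{R}^3$ with $\|w\|=1$ and $\alpha\in\mathbb{R}$ such that $\mathbf V(x)\cdot w\ge\alpha>0$ for all $x\in\mathbb{R}^3$. In cylindrical coordinates $(\rho,\theta,z)$: $\mathbf e_\rho=(\cos\theta,\sin\theta,0)$, $\mathbf e_\theta=(-\sin\theta,\cos\theta,0)$, $\mathbf e_z=(0,0,1)$. *)

(* Defs.v *)
From HB Require Import structures.
From mathcomp Require Export all_boot all_order all_algebra.
From mathcomp Require Export all_classical all_reals all_analysis.

Set Implicit Arguments.
Unset Strict Implicit.
Unset Printing Implicit Defensive.

Export Order.TTheory GRing.Theory Num.Theory.
Export numFieldNormedType.Exports.

Local Open Scope classical_set_scope.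
Local Open Scope ring_scope.

Section Euclidean.
Context {R : realType} {n : nat}.
Implicit Types u v : 'rV[R]_n.

Definition dotv u v : R := \sum_i u 0 i * v 0 i.

(* The norm `|u| of the library is the sup norm; Lipschitz continuity and
   boundedness, for which it is used, do not depend on the choice of norm. *)
Definition enorm u : R := Num.sqrt (dotv u u).

Definition eball (p : 'rV[R]_n) (r : R) : set 'rV[R]_n :=
  [set x | enorm (x - p) < r].

End Euclidean.

Section Space.
Context {R : realType}.
Local Notation R3 := 'rV[R]_3.

Definition vec3 (a b c : R) : R3 := \row_i [:: a; b; c]`_i.

Definition orthonormal_basis (u1 u2 u3 : R3) : Prop :=
  let u := [:: u1; u2; u3] in
  (forall i j : 'I_3, dotv u`_i u`_j = (i == j)%:R) /\ basis_of fullv u.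

Definition cart (rho theta z : R) : R3 := vec3 (rho * cos theta) (rho * sin theta) z.

Definition z_axis : set R3 := [set x | x 0 0 = 0 /\ x 0 1 = 0].

Definition radius (x : R3) : R := Num.sqrt (x 0 0 ^+ 2 + x 0 1 ^+ 2).

(* Values in ]-pi, pi]; e_rho and e_theta do not depend on the branch. *)
Definition azimuth (x : R3) : R :=
  let t := acos (x 0 0 / radius x) in if 0 <= x 0 1 then t else - t.

Definition e_rho (x : R3) : R3 := vec3 (cos (azimuth x)) (sin (azimuth x)) 0.
Definition e_theta (x : R3) : R3 := vec3 (- sin (azimuth x)) (cos (azimuth x)) 0.
Definition e_z (x : R3) : R3 := vec3 0 0 1.

Lemma cartK (x : R3) : ~ z_axis x ->
  0 < radius x /\ cart (radius x) (azimuth x) (x 0 2) = x.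
Proof.
move=> xNz; set a := x 0 0; set b := x 0 1.
have ab0 : 0 < a ^+ 2 + b ^+ 2.
  rewrite lt_neqAle addr_ge0 ?sqr_ge0// andbT eq_sym paddr_eq0 ?sqr_ge0//.
  by rewrite !sqrf_eq0; apply/negP => /andP[/eqP a0 /eqP b0]; apply: xNz.
have r0 : 0 < radius x by rewrite /radius sqrtr_gt0.
split => //; have rE : radius x ^+ 2 = a ^+ 2 + b ^+ 2.
  by rewrite /radius sqr_sqrtr// ltW.
have br : `|a / radius x| <= 1.
  rewrite normrM normfV (gtr0_norm r0) ler_pdivrMr// mul1r.
  rewrite -(@ler_pXn2r _ 2)// ?nnegrE ?(ltW r0)//.
  by rewrite real_normK ?num_real// rE lerDl sqr_ge0.
have br' : -1 <= a / radius x <= 1 by rewrite -ler_norml.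
have cosE : radius x * cos (azimuth x) = a.
  rewrite /azimuth; case: ifP => _; rewrite ?cosN acosK ?in_itv//=;
  by rewrite mulrC divfK// gt_eqF.
have sinE : radius x * sin (azimuth x) = b.
  have E : radius x * sin (acos (a / radius x)) = `|b|.
    rewrite sin_acos// -sqrtr_sqr -[X in X * _](ger0_norm (ltW r0)) -sqrtr_sqr.
    rewrite -sqrtrM ?sqr_ge0// mulrBr mulr1 exprMn exprVn mulrCA divff ?mulr1.
      by rewrite rE addrAC subrr add0r.
    by rewrite expf_eq0 gt_eqF.
  rewrite /azimuth -/a -/b; case: ifPn => b0; first by rewrite E ger0_norm.
  by rewrite sinN mulrN E ltr0_norm ?opprK// ltNge.
rewrite /cart cosE sinE; apply/rowP => i; rewrite mxE.
by case: i => -[|[|[|//]]] i3 /=; congr (x _ _); apply/val_inj.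
Qed.

(* V is of class C^1 on the open set U; its values off U are irrelevant. *)
Definition C1_on (U : set R3) (V : R3 -> R3) : Prop :=
  forall x, U x -> differentiable V x /\ {for x, continuous (jacobian V)}.

Definition globally_directed (V : R3 -> R3) : Prop :=
  exists w : R3, enorm w = 1 /\
    exists2 alpha : R, 0 < alpha & forall x, alpha <= dotv (V x) w.

Definition is_domain (Omega : set R3) : Prop :=
  [/\ open Omega, connected Omega & Omega !=set0].

(* Up to an isometry x |-> x *m Q, near each of its boundary points Omega is
   the strict epigraph of a Lipschitz function of the first two coordinates. *)
Definition lipschitz_boundary (Omega : set R3) : Prop :=
  forall p, closure Omega p -> ~ interior Omega p ->
  exists (Q : 'M[R]_3) (r : R) (g : 'rV[R]_2 -> R),
  [/\ Q *m Q^T = 1%:M, 0 < r, lipschitz g &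
      Omega `&` eball p r =
      [set x | g (col' ord_max (x *m Q)) < (x *m Q) 0 ord_max] `&` eball p r].

End Space.

(* Main.v *)
Require Import Defs.
From mathcomp Require Import ring lra finmap.

Local Open Scope classical_set_scope.
Local Open Scope ring_scope.

(** Since [b . e_theta > 0], the unit vector [b] is never vertical on [U], so
    that the projection of [e_z] on the plane orthogonal to [b] does not vanish.
    Its normalization [n] is of class C^1 on [U], and
    [n . e_z = sqrt (1 - (b . e_z)^2) > 0]. Take a C^1 cutoff function [phi],
    equal to [1] on the compact set [closure Omega] and vanishing outside of a
    compact subset of [U]; then [B3 := phi n + (1 - phi) e_z] is C^1 on the
    whole space, constant outside of a compact set, and [B3 . e_z] is bounded
    away from [0]. The fields [phi b], [B3] and their cross product are globally
    C^1, hence Lipschitz on every bounded set by the mean value theorem on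
    segments. *)

Section LipschitzFrame.
Set Implicit Arguments.
Unset Strict Implicit.
Unset Printing Implicit Defensive.

(** * C^1 functions and fields *)

Section Calculus.
Context {R : realType}.

(** A differential depends only on the germ: the first order expansion of [f] at [x] is also one for
    [g], and uniqueness of the differential concludes. *)
Lemma near_eq_diff (V W : normedModType R) (f g : V -> W) x :
  (\forall y \near x, f y = g y) -> differentiable f x ->
  differentiable g x /\ 'd g x = 'd f x :> (V -> W).
Proof.
move=> fg df; have [dfc dfE] := (diff_locallyP _ _).1 df.
have fgx : f x = g x by exact: nbhs_singleton fg.
have gE : g \o shift x = cst (g x) + 'd f x +o_ 0 id.
  apply/eqaddoP => e e0.
  have : \forall h \near (0 : V), f (h + x) = g (h + x).
    by move/nbhs0P : fg; apply: filterS => h; rewrite addrC.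
  move/eqaddoP : dfE => /(_ e e0).
  apply: filterS2 => h.
  by rewrite !fctE /= fgx => + <-.
have gd : 'd g x = 'd f x :> (V -> W) by exact: diff_unique.
split; last exact: gd.
by apply/diff_locallyP; split; rewrite gd.
Qed.

(** Continuity is asked of each directional derivative and at [x] only. No topology on linear maps
    is then needed, and the algebraic rules can be proved one point at a time; on row vectors this
    amounts to continuity of the partial derivatives at [x]. *)
Variant C1pt (V : normedModType R) (f : V -> R) (x : V) : Prop :=
  C1pt_intro of (\forall y \near x, differentiable f y)
  & (forall v, {for x, continuous (fun y => 'd f y v)}).

Section Scalar.
Variable V : normedModType R.
Implicit Types (f g : V -> R) (x : V).

Lemma C1pt_diff f x : C1pt f x -> differentiable f x.
Proof. by case=> /nbhs_singleton. Qed.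

Lemma C1pt_continuous f x : C1pt f x -> {for x, continuous f}.
Proof. by move/C1pt_diff/differentiable_continuous. Qed.

Lemma C1pt_near_eq f g x :
  (\forall y \near x, f y = g y) -> C1pt f x -> C1pt g x.
Proof.
move=> fg [df cf].
have fgy : \forall y \near x, differentiable g y /\ 'd g y = 'd f y :> (V -> R).
  move: df (near_join fg); apply: filterS2 => y dfy fgy.
  exact: near_eq_diff fgy dfy.
split; first by apply: filterS fgy => y [dgy _]; exact: dgy.
move=> v; rewrite /prop_for /continuous_at.
have -> : 'd g x v = 'd f x v by have [_ ->] := nbhs_singleton fgy.
apply: cvg_trans (cf v); apply: near_eq_cvg.
by apply: filterS fgy => y [_ ->].
Qed.

Lemma C1pt_cst (c : R) x : C1pt (cst c) x.
Proof.
split; first by near=> y; exact: differentiable_cst.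
move=> v; rewrite (_ : (fun y => _) = cst 0).
  exact: cst_continuous.
by apply/funext => y; rewrite diff_cst.
Unshelve. all: by end_near. Qed.

Lemma C1ptD f g x : C1pt f x -> C1pt g x -> C1pt (fun y => f y + g y) x.
Proof.
move=> [df cf] [dg cg].
have E y v : differentiable f y -> differentiable g y ->
    'd (f + g) y v = 'd f y v + 'd g y v.
  by move=> dfy dgy; rewrite (diffD dfy dgy).
split; first by apply: filterS2 df dg => y dfy dgy; exact: differentiableD.
move=> v; rewrite /prop_for /continuous_at.
rewrite (E x v (nbhs_singleton df) (nbhs_singleton dg)).
apply: cvg_trans (cvgD (cf v) (cg v)); apply: near_eq_cvg.
by apply: filterS2 df dg => y dfy dgy; rewrite (E y v dfy dgy).
Qed.

Lemma C1ptM f g x : C1pt f x -> C1pt g x -> C1pt (fun y => f y * g y) x.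
Proof.
move=> C1f C1g; have [df cf] := C1f; have [dg cg] := C1g.
have E y v : differentiable f y -> differentiable g y ->
    'd (f * g) y v = f y * 'd g y v + g y * 'd f y v.
  by move=> dfy dgy; rewrite (diffM dfy dgy).
split; first by apply: filterS2 df dg => y dfy dgy; exact: differentiableM.
move=> v; rewrite /prop_for /continuous_at.
rewrite (E x v (nbhs_singleton df) (nbhs_singleton dg)).
have cfx := C1pt_continuous C1f; have cgx := C1pt_continuous C1g.
apply: cvg_trans (cvgD (cvgM cfx (cg v)) (cvgM cgx (cf v))).
apply: near_eq_cvg.
by apply: filterS2 df dg => y dfy dgy; rewrite (E y v dfy dgy).
Qed.

Lemma C1ptN f x : C1pt f x -> C1pt (fun y => - f y) x.
Proof.
move=> C1f; rewrite (_ : (fun y => _) = (fun y => cst (-1) y * f y)).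
  by apply: C1ptM => //; exact: C1pt_cst.
by apply/funext => y; rewrite mulN1r.
Qed.

Lemma C1ptB f g x : C1pt f x -> C1pt g x -> C1pt (fun y => f y - g y) x.
Proof. by move=> C1f C1g; apply: C1ptD => //; exact: C1ptN. Qed.

Lemma C1ptX f n x : C1pt f x -> C1pt (fun y => f y ^+ n) x.
Proof.
move=> C1f; elim: n => [|n ih]; first exact: C1pt_cst.
rewrite (_ : (fun y => _) = (fun y => f y * f y ^+ n)).
  exact: C1ptM.
by apply/funext => y; rewrite exprS.
Qed.

Lemma C1pt_prod (I : Type) (s : seq I) (F : I -> V -> R) x :
  (forall i, C1pt (F i) x) -> C1pt (fun y => \prod_(i <- s) F i y) x.
Proof.
move=> C1F; elim: s => [|i s ih].
  rewrite (_ : (fun y => _) = cst 1); first exact: C1pt_cst.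
  by apply/funext => y; rewrite big_nil.
rewrite (_ : (fun y => _) = (fun y => F i y * \prod_(i <- s) F i y)).
  exact: C1ptM.
by apply/funext => y; rewrite big_cons.
Qed.

Lemma C1pt_sum (I : Type) (s : seq I) (F : I -> V -> R) x :
  (forall i, C1pt (F i) x) -> C1pt (fun y => \sum_(i <- s) F i y) x.
Proof.
move=> C1F; elim: s => [|i s ih].
  rewrite (_ : (fun y => _) = cst 0); first exact: C1pt_cst.
  by apply/funext => y; rewrite big_nil.
rewrite (_ : (fun y => _) = (fun y => F i y + \sum_(i <- s) F i y)).
  exact: C1ptD.
by apply/funext => y; rewrite big_cons.
Qed.

Lemma C1pt_comp (h : R -> R) f x :
  C1pt h (f x) -> C1pt f x -> C1pt (fun y => h (f y)) x.
Proof.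
move=> C1h C1f; have [dh ch] := C1h; have [df cf] := C1f.
have cfx := C1pt_continuous C1f.
have dhf : \forall y \near x, differentiable h (f y) by exact: (cfx _ dh).
(* Since [h] has one real variable, ['d h (f y)] is multiplication by its value at [1], and the
   chain rule becomes a product of two continuous factors. *)
have E y v : differentiable f y -> differentiable h (f y) ->
    'd (h \o f) y v = 'd f y v * 'd h (f y) 1.
  move=> dfy dhy; rewrite (diff_comp dfy dhy) /=.
  by rewrite -{1}['d f y v]mulr1 -[LHS]/('d h (f y) ('d f y v *: 1)) linearZ.
split; first by apply: filterS2 df dhf => y dfy dhy; exact: differentiable_comp.
move=> v; rewrite /prop_for /continuous_at.
rewrite (E x v (nbhs_singleton df) (nbhs_singleton dh)).
have : (fun y => 'd f y v * 'd h (f y) 1) @ x --> 'd f x v * 'd h (f x) 1.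
  by apply: cvgM; [exact: cf|exact: (cvg_comp _ _ cfx (ch 1))].
apply: cvg_trans; apply: near_eq_cvg.
by apply: filterS2 df dhf => y dfy dhy; rewrite (E y v dfy dhy).
Qed.

End Scalar.

Lemma C1pt_is_derive (h dh : R -> R) (a : R) :
  (\forall t \near a, is_derive (t : R) 1 h (dh t)) -> {for a, continuous dh} ->
  C1pt h a.
Proof.
move=> hdh cdh; split.
  by apply: filterS hdh => t ht; apply/derivable1_diffP.
move=> v.
have E (t : R) : is_derive t 1 h (dh t) -> 'd h t v = v * dh t.
  by move=> ht; rewrite deriv1E//= derive1E derive_val.
rewrite /prop_for /continuous_at.
have ha : is_derive a 1 h (dh a) by exact: (nbhs_singleton hdh).
have Ea := E a ha.
rewrite [X in _ --> X]Ea.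
have : (fun t => v * dh t) @ a --> v * dh a.
  by apply: cvgM => //; exact: cvg_cst.
apply: cvg_trans; apply: near_eq_cvg.
by apply: filterS hdh => t ht; rewrite (E t ht).
Qed.

(** Bundled as a linear map so that [diff_lin] computes its differential. *)
Definition coordl m n (i : 'I_m) (j : 'I_n) : {linear 'M[R]_(m, n) -> R}.
Proof.
by exists (fun N : 'M[R]_(_, _) => N i j); do 2![eexists]; do ?[constructor];
   rewrite ?mxE// => ? *; rewrite ?mxE//; move=> ?; rewrite !mxE.
Defined.

Lemma C1pt_coord m n (i : 'I_m) (j : 'I_n) (x : 'M[R]_(m, n)) :
  C1pt (fun y : 'M[R]_(m, n) => y i j) x.
Proof.
split; first by near=> y; exact: differentiable_coord.
move=> v; rewrite (_ : (fun y => _) = cst (v i j)); first exact: cst_continuous.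
apply/funext => y; rewrite -[LHS]/('d (coordl i j) y v) diff_lin//.
exact: coord_continuous.
Unshelve. all: by end_near. Qed.

Lemma C1pt_invsqrt (a : R) : 0 < a -> C1pt (fun t => (Num.sqrt t)^-1) a.
Proof.
move=> a0.
have C1s : C1pt (@Num.sqrt R) a.
  apply: (@C1pt_is_derive _ (fun t => (2 * Num.sqrt t)^-1)).
    near=> t; apply: is_derive1_sqrt; near: t; exact: lt_nbhsr.
  apply: cvgV; first by rewrite mulf_neq0// gt_eqF// sqrtr_gt0.
  apply: cvgM; [exact: cvg_cst|exact: sqrt_continuous].
apply: (C1pt_comp _ C1s) => /=.
have s0 : 0 < Num.sqrt a by rewrite sqrtr_gt0.
apply: (@C1pt_is_derive _ (fun t => - t ^- 2)).
  near=> t.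
  have t0 : t != 0 by rewrite gt_eqF//; near: t; exact: lt_nbhsr.
  apply: is_derive_eq; first exact: is_deriveV.
  by rewrite /GRing.scale /= mulr1.
apply: cvgN; apply: cvgV; first by rewrite expf_neq0// gt_eqF.
by apply: exprn_continuous.
Unshelve. all: by end_near. Qed.

(** Squaring the positive part removes its corner at [0], which gives an elementary C^1 function
    positive exactly on the positive half-line; cutoffs of class C^1 require nothing smoother. *)
Definition sqpos (t : R) : R := Num.max t 0 ^+ 2.

Lemma C1pt_sqpos a : C1pt sqpos a.
Proof.
apply: (@C1pt_is_derive _ (fun t => 2 * Num.max t 0)); last first.
  apply: cvgM; first exact: cvg_cst.
  apply: (@continuous_max _ _ id (cst 0)); first exact: cvg_id.
  exact: cst_continuous.
apply: filterE => t.
have [t0|t0|->] := ltgtP t 0.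
- rewrite mulr0.
  have E : \forall u \near t, cst 0 u = sqpos u.
    have : \forall u \near t, u < 0 by exact: lt_nbhsl.
    by apply: filterS => u u0; rewrite /sqpos max_r ?ltW// expr0n.
  exact: (near_eq_is_derive E (is_derive_cst _ _ _)).
- have E : \forall u \near t, u ^+ 2 = sqpos u.
    have : \forall u \near t, 0 < u by exact: lt_nbhsr.
    by apply: filterS => u u0; rewrite /sqpos max_l ?ltW.
  apply: (near_eq_is_derive E).
  apply: is_derive_eq.
  rewrite /GRing.scale /= ?expr1 ?mulr1; ring.
- rewrite ?maxxx mulr0.
  (* At [0] the difference quotient is [0] for [h < 0] and [h] for [h > 0], so it is squeezed
     between [- |h|] and [|h|]. *)
  have H : (fun h => h^-1 *: ((sqpos \o shift (0 : R)) (h *: 1) - sqpos 0))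
      @ 0^' --> (0 : R).
    have nh : (fun h : R => `|h|) @ 0^' --> (0 : R).
      rewrite -[X in _ --> X](@normr0 R R); apply: cvg_norm.
      exact: nbhs_dnbhs.
    have nh' : (fun h : R => - `|h|) @ 0^' --> (0 : R).
      by rewrite -[X in _ --> X](@oppr0 R); apply: cvgN.
    apply: squeeze_cvgr nh' nh; near=> h.
    have h0 : h != 0 by near: h; exact: nbhs_dnbhs_neq.
    rewrite -ler_norml /sqpos /= addr0 /GRing.scale /= mulr1 maxxx expr0n /=.
    rewrite subr0.
    have [hp|hn] := leP h 0; first by rewrite expr0n mulr0 normr0.
    by rewrite expr2 mulKf.
  apply: DeriveDef; first by apply/cvg_ex; exists 0; exact: H.
  exact: cvg_lim H.
Unshelve. all: by end_near. Qed.

End Calculus.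

(** * Vector fields by coordinates, Lipschitz and Jacobian bounds *)

Section Vector.
Context {R : realType}.

Lemma near_eq_continuous_at (T W : topologicalType) (f g : T -> W) x :
  (\forall y \near x, f y = g y) ->
  {for x, continuous f} -> {for x, continuous g}.
Proof.
move=> fg cf; rewrite /prop_for /continuous_at -(nbhs_singleton fg).
by apply: cvg_trans cf; exact: near_eq_cvg.
Qed.

Lemma diff_coord n m (F : 'rV[R]_n -> 'rV[R]_m) x j v : differentiable F x ->
  'd (fun y => F y 0 j) x v = 'd F x v 0 j.
Proof.
move=> dF; pose cj := @coordl R 1 m 0 j.
have cl : continuous cj by exact: coord_continuous.
have dl : differentiable cj (F x) by exact: linear_differentiable.
have -> : (fun y => F y 0 j) = cj \o F by [].
by rewrite (diff_comp dF dl) /= (diff_lin _ cl).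
Qed.

Lemma differentiable_row n m (F : 'rV[R]_n -> 'rV[R]_m) x :
  (forall j, differentiable (fun y => F y 0 j) x) -> differentiable F x.
Proof.
move=> dF.
have -> : F = \sum_(j < m) (fun y => F y 0 j *: delta_mx 0 j).
  by apply/funext => y; rewrite fct_sumE; exact: row_sum_delta.
by apply: differentiable_sum => j; apply: differentiableZl.
Qed.

Lemma jacobian_coord n m (F : 'rV[R]_n -> 'rV[R]_m) x i j :
  differentiable F x ->
  jacobian F x i j = 'd (fun y => F y 0 j) x (delta_mx 0 i).
Proof. by move=> dF; rewrite (diff_coord _ _ dF) mxE. Qed.

Lemma cvg_mx (T : Type) (H : set_system T) (FH : Filter H) m n
    (M : T -> 'M[R]_(m, n)) (N : 'M[R]_(m, n)) :
  (forall i j, (fun t => M t i j) @ H --> N i j) -> M @ H --> N.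
Proof.
move=> cM.
have -> : M = fun t => \sum_i \sum_j M t i j *: delta_mx i j.
  by apply/funext => t; exact: matrix_sum_delta.
rewrite [X in _ --> X]matrix_sum_delta.
apply: (cvg_big add_continuous) => i _.
apply: (cvg_big add_continuous) => j _.
apply: cvgZr_tmp; exact: cM.
Qed.

(** Passage from scalar [C1pt] back to the formulation used in [C1_on]: the entries of the Jacobian
    are the differentials of the coordinates along the canonical basis. *)
Lemma C1pt_row n m (F : 'rV[R]_n -> 'rV[R]_m) x :
  (forall j, C1pt (fun y => F y 0 j) x) ->
  differentiable F x /\ {for x, continuous (jacobian F)}.
Proof.
move=> C1F.
have dF : \forall y \near x, forall j, differentiable (fun y => F y 0 j) y.
  have H := @filter_forall _ 'I_m
    (fun j y => differentiable (fun z => F z 0 j) y) (nbhs x) _.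
  by apply: H => j; case: (C1F j).
have {}dF : \forall y \near x, differentiable F y.
  by apply: filterS dF => y; exact: differentiable_row.
have dFx := nbhs_singleton dF; split; first exact: dFx.
have H := @cvg_mx _ (nbhs x) _ _ _ (jacobian F) (jacobian F x).
apply: H => i j; rewrite [X in _ --> X](jacobian_coord _ _ dFx).
have [_ /(_ (delta_mx 0 i))] := C1F j.
apply: cvg_trans; apply: near_eq_cvg.
by apply: filterS dF => y dFy; rewrite (jacobian_coord i j dFy).
Qed.

(** The opposite passage. Openness of [U] gives differentiability near [x], and for fixed [v] the
    directional derivative of a coordinate is a fixed linear combination of Jacobian entries. *)
Lemma C1_on_coord (U : set 'rV[R]_3) (F : 'rV[R]_3 -> 'rV[R]_3) x j :
  open U -> C1_on U F -> U x -> C1pt (fun y => F y 0 j) x.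
Proof.
move=> oU C1F Ux.
have nU : \forall y \near x, U y by exact: open_nbhs_nbhs.
have dFj y : differentiable F y -> differentiable (fun z => F z 0 j) y.
  move=> dF.
  exact: (differentiable_comp dF (differentiable_coord (F y) 0 j)).
split; first by apply: filterS nU => y /C1F[dF _]; exact: dFj.
move=> v.
have E y : differentiable F y ->
    'd (fun z => F z 0 j) y v = \sum_k v 0 k * jacobian F y k j.
  move=> dF; rewrite (diff_coord _ _ dF) -(deriveE _ dF) (deriveEjacobian _ dF).
  by rewrite mxE.
have [dFx cJ] := C1F x Ux.
have nE : \forall y \near x,
    \sum_k v 0 k * jacobian F y k j = 'd (fun z => F z 0 j) y v.
  by apply: filterS nU => y /C1F[dF _]; rewrite (E y dF).
have : (fun y => \sum_k v 0 k * jacobian F y k j) @ x -->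
    \sum_k v 0 k * jacobian F x k j.
  have H := @cvg_big _ _ _ _ predT add_continuous _ (nbhs x) (index_enum 'I_3)
    (fun k y => v 0 k * jacobian F y k j) (fun k => v 0 k * jacobian F x k j) _.
  apply: H => k _; apply: cvgM; first exact: cvg_cst.
  exact: (cvg_comp _ _ cJ (@coord_continuous _ _ _ k j _)).
exact: (near_eq_continuous_at nE).
Qed.

Lemma compact_le_norm n (r : R) : compact [set x : 'rV[R]_n | `|x| <= r].
Proof.
apply: bounded_closed_compact.
  exists r; split; first exact: num_real.
  by move=> s rs x /= /le_trans -> //; exact: ltW.
apply: (@preimage_closed _ _ (@Num.norm _ 'rV[R]_n) [set y | y <= r]).
  by move=> x _; exact: norm_continuous.
exact: closed_le.
Qed.

Lemma row_norm_le n (x : 'rV[R]_n) (M : R) : 0 <= M ->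
  (forall i, `|x 0 i| <= M) -> `|x| <= M.
Proof.
move=> M0 xM; rewrite -[leLHS]/(mx_norm x) mx_normrE.
apply/bigmax_leP; split => //.
by case=> i j _ /=; rewrite ord1.
Qed.

Lemma row_norm_ge n (x : 'rV[R]_n) i : `|x 0 i| <= `|x|.
Proof.
rewrite -[leRHS]/(mx_norm x) mx_normrE.
exact: (le_bigmax _ (fun ij : 'I_1 * 'I_n => `|x ij.1 ij.2|) (0, i)).
Qed.

Lemma compact_bound (T : topologicalType) (W : normedModType R) (A : set T)
    (f : T -> W) :
  compact A -> (forall x, A x -> {for x, continuous f}) ->
  exists2 M, 0 <= M & forall x, A x -> `|f x| <= M.
Proof.
move=> cA cf.
have : compact (f @` A).
  apply: continuous_compact cA; apply: continuous_in_subspaceT => x.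
  by move/set_mem; exact: cf.
move/compact_bounded/ex_strict_bound_gt0 => [M /ltW M0 fM].
by exists M => // x Ax; apply/ltW/fM; exists x.
Qed.

(** [A] need not be convex, but it lies in a closed ball, which is convex and compact: the partial
    derivatives are bounded there, and the mean value theorem applies along the segment from [y] to
    [x] inside the ball. *)
Lemma C1pt_lipschitz_bounded n (f : 'rV[R]_n -> R) (A : set 'rV[R]_n) :
  (forall x, C1pt f x) -> bounded_set A ->
  exists2 M, 0 <= M & forall x y, A x -> A y -> `|f x - f y| <= M * `|x - y|.
Proof.
move=> C1f /ex_strict_bound_gt0[r r0 Ar].
have cB : compact [set x : 'rV[R]_n | `|x| <= r] by exact: compact_le_norm.
have /choice[M M_] : forall i : 'I_n, exists M,
    0 <= M /\ forall x, `|x| <= r -> `|'d f x (delta_mx 0 i)| <= M.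
  move=> i.
  have [|M M0 fM] :=
      @compact_bound _ _ _ (fun x => 'd f x (delta_mx 0 i)) cB.
    by move=> x _; case: (C1f x) => _; apply.
  by exists M; split.
exists (\sum_i M i); first by apply: sumr_ge0 => i _; have [] := M_ i.
move=> x y Ax Ay.
pose g (t : R) := f (y + t *: (x - y)).
have dg (t : R) : is_derive t 1 g ('d f (y + t *: (x - y)) (x - y)).
  have df : differentiable f (y + t *: (x - y)) by exact: C1pt_diff.
  (* The difference quotients of [g] at [t] are those of [f] at the corresponding point in the
     direction [x - y]. *)
  have E : (fun h : R => h^-1 *: ((g \o shift t) (h *: 1) - g t)) =
      (fun h : R => h^-1 *: ((f \o shift (y + t *: (x - y))) (h *: (x - y))
                             - f (y + t *: (x - y)))).
    apply/funext => h; rewrite /g /=; congr (_ *: (f _ - _)).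
    by rewrite [h *: 1]mulr1 scalerDl addrCA.
  apply: DeriveDef.
    by rewrite /derivable E; apply: diff_derivable.
  by rewrite -deriveE// /derive E.
have gc : {within `[0 : R, 1], continuous g}.
  by apply: derivable_within_continuous => t _; exact: ex_derive.
have [c c01] := MVT_segment ler01 (fun t _ => dg t) gc.
rewrite /g scale1r scale0r addr0 subr0 mulr1 subrKC => ->.
set p := y + _; have pr : `|p| <= r.
  have -> : p = (1 - c) *: y + c *: x.
    by rewrite /p scalerBr scalerBl scale1r addrA addrAC.
  move: c01; rewrite in_itv /= => /andP[c0 c1].
  apply: (le_trans (ler_normD _ _)); rewrite !normrZ (ger0_norm c0).
  rewrite ger0_norm ?subr_ge0//.
  rewrite [leRHS](_ : r = (1 - c) * r + c * r); last by ring.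
  by apply: lerD; apply: ler_wpM2l; rewrite ?subr_ge0//; apply/ltW/Ar.
(* Expanding [x - y] on the canonical basis reduces the bound to the partial derivatives at [p]. *)
rewrite [X in 'd f p X]row_sum_delta linear_sum mulr_suml.
apply: (le_trans (ler_norm_sum _ _ _)); apply: ler_sum => i _.
rewrite linearZ /= normrM mulrC; apply: ler_pM => //.
  by have [_] := M_ i; apply.
exact: row_norm_ge.
Qed.

Lemma C1pt_row_lipschitz n m (F : 'rV[R]_n -> 'rV[R]_m) (A : set 'rV[R]_n) :
  (forall x j, C1pt (fun y => F y 0 j) x) -> bounded_set A ->
  [lipschitz F x | x in A].
Proof.
move=> C1F bA.
have /choice[M M_] : forall j : 'I_m, exists M, 0 <= M /\
    forall x y, A x -> A y -> `|F x 0 j - F y 0 j| <= M * `|x - y|.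
  move=> j; have [M M0 FM] := C1pt_lipschitz_bounded (C1F^~ j) bA.
  by exists M; split.
have S0 : 0 <= \sum_j M j by apply: sumr_ge0 => j _; have [] := M_ j.
(* The Lipschitz property is stated for all large enough constants; those above the sum of the
   coordinate constants work for the sup norm. *)
rewrite /lipschitz_on; near=> K => -[x y] [/= Ax Ay].
have SK : \sum_j M j <= K by near: K; apply: nbhs_pinfty_ge; exact: num_real.
apply: (@le_trans _ _ ((\sum_j M j) * `|x - y|)); last by rewrite ler_wpM2r.
apply: row_norm_le => [|j]; first by rewrite mulr_ge0.
rewrite !mxE; have [_ /(_ x y Ax Ay)] := M_ j => /le_trans; apply.
apply: ler_wpM2r => //; rewrite (bigD1 j)//= lerDl.
by apply: sumr_ge0 => i _; have [] := M_ i.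
Unshelve. all: by end_near. Qed.

(** On [L] the bound comes from compactness; the complement of [L] is open, so [F] is locally
    constant there and its Jacobian vanishes. *)
Lemma bounded_jacobian n m (F : 'rV[R]_n -> 'rV[R]_m) (L : set 'rV[R]_n) c :
  (forall x j, C1pt (fun y => F y 0 j) x) -> compact L ->
  (forall x, ~ L x -> F x = c) -> bounded_fun (jacobian F).
Proof.
move=> C1F cL Fc.
have [|M M0 JM] := @compact_bound _ _ _ (jacobian F) cL.
  by move=> x _; have [] := C1pt_row (C1F x).
exists M; split; first exact: num_real.
move=> K /ltW MK x _; apply: le_trans MK.
have [Lx|NLx] := pselect (L x); first exact: JM.
have oL : open (~` L).
  exact: (closed_openC (compact_closed (@norm_hausdorff _ _) cL)).
have nx : \forall y \near x, cst c y = F y.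
  have : \forall y \near x, (~` L) y by exact: open_nbhs_nbhs.
  by apply: filterS => y /Fc ->.
have [dF d0] := near_eq_diff nx (differentiable_cst c x).
suff -> : jacobian F x = 0 by rewrite normr0.
apply/matrixP => i j; rewrite !mxE d0 diff_cst.
by rewrite /cst /= mxE.
Qed.

End Vector.

(** * Cutoff functions *)

Section Bump.
Context {R : realType}.

Lemma sqpos_ge0 (t : R) : 0 <= sqpos t. Proof. exact: sqr_ge0. Qed.

Lemma sqpos_gt0 (t : R) : 0 < t -> 0 < sqpos t.
Proof. by move=> t0; rewrite /sqpos max_l ?ltW// exprn_gt0. Qed.

Lemma sqpos_eq0 (t : R) : t <= 0 -> sqpos t = 0.
Proof. by move=> t0; rewrite /sqpos max_r// expr0n. Qed.

(** Balls of the sup norm are cubes, so a product of one-variable bumps is adapted to them: for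
    [r > 0] it is positive exactly on the open ball. *)
Definition cube_bump n (c : 'rV[R]_n) (r : R) (x : 'rV[R]_n) : R :=
  \prod_(i < n) sqpos (r ^+ 2 - (x 0 i - c 0 i) ^+ 2).

Lemma C1pt_cube_bump n (c : 'rV[R]_n) r x : C1pt (cube_bump c r) x.
Proof.
apply: C1pt_prod => i; apply: C1pt_comp; first exact: C1pt_sqpos.
apply: C1ptB; first exact: C1pt_cst.
apply: C1ptX; apply: C1ptB; last exact: C1pt_cst.
exact: C1pt_coord.
Qed.

Lemma cube_bump_ge0 n (c : 'rV[R]_n) r x : 0 <= cube_bump c r x.
Proof. by apply: prodr_ge0 => i _; exact: sqpos_ge0. Qed.

Lemma cube_bump_gt0 n (c : 'rV[R]_n) r x : ball c r x -> 0 < cube_bump c r x.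
Proof.
rewrite -ball_normE /= => cx; apply: prodr_gt0 => i _; apply: sqpos_gt0.
have r0 : 0 < r by exact: le_lt_trans cx.
rewrite subr_gt0 -[ltLHS]real_normK ?num_real//.
rewrite ltr_pXn2r ?nnegrE ?normr_ge0 ?(ltW r0)//.
apply: le_lt_trans cx; rewrite distrC; have := row_norm_ge (c - x) i.
by rewrite !mxE.
Qed.

Lemma cube_bump_eq0 n (c : 'rV[R]_n) r x : 0 < r ->
  ~ `|c - x| <= r -> cube_bump c r x = 0.
Proof.
move=> r0 /negP; rewrite -ltNge => cx.
have [i ri] : exists i : 'I_n, r < `|(c - x) 0 i|.
  apply: contrapT => /forallNP Nr; move: cx; rewrite ltNge => /negP; apply.
  apply: row_norm_le => [|i]; first exact: ltW.
  by rewrite leNgt; exact/negP.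
rewrite /cube_bump (bigD1 i)//= sqpos_eq0 ?mul0r//.
move: ri; rewrite !mxE distrC => ri.
rewrite subr_le0 -[leRHS]real_normK ?num_real//.
by rewrite ler_pXn2r ?nnegrE ?normr_ge0 ?(ltW r0)// ltW.
Qed.

(** Finitely many balls with closures in [U] cover [K]. The sum [g] of their bumps has a positive
    minimum on [K], and a C^1 profile in one variable levels [g] to [1] above this minimum. *)
Lemma C1_bump n (K U : set 'rV[R]_n) :
  compact K -> K !=set0 -> open U -> K `<=` U ->
  exists (phi : 'rV[R]_n -> R) (L : set 'rV[R]_n),
    [/\ forall x, C1pt phi x, forall x, 0 <= phi x <= 1,
      forall x, K x -> phi x = 1, compact L /\ L `<=` U
    & forall x, ~ L x -> phi x = 0].
Proof.
move=> cK K0 oU KU.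
have /choice[rho rhoP] : forall c : 'rV[R]_n, exists r : R,
    K c -> 0 < r /\ closed_ball_ Num.norm c r `<=` U.
  (* The radius [0] off [K] is a dummy value: the finite subcover is centred at points of [K]. *)
  move=> c; have [Kc|NKc] := pselect (K c); last by exists 0.
  have /nbhs_ballP[e /= e0 eU] : nbhs c U.
    by apply: open_nbhs_nbhs; split; [|exact: KU].
  (* Halving the radius puts the closed ball, and not only the open one, inside [U]. *)
  exists (e / 2) => _; split; first by rewrite divr_gt0.
  move=> y cy; apply: eU; rewrite -ball_normE /=; apply: (le_lt_trans cy).
  by rewrite ltr_pdivrMr// ltr_pMr// ltr1n.
have covK : cover_compact K by rewrite -compact_cover.
have := covK 'rV[R]_n K (fun c => ball c (rho c)).
case=> [c Kc| x Kx|D DK KD].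
- exact: ball_open.
- by exists x => //; apply: ballxx; have [] := rhoP _ Kx.
pose g x := \sum_(c <- D) cube_bump c (rho c) x.
have C1g x : C1pt g x by apply: C1pt_sum => c; exact: C1pt_cube_bump.
have g0 x : 0 <= g x by apply: sumr_ge0 => c _; exact: cube_bump_ge0.
have gK x : K x -> 0 < g x.
  move=> /KD [c /= cD cx]; rewrite /g (big_rem c)//=.
  by rewrite ltr_pwDl ?cube_bump_gt0// sumr_ge0// => i _; exact: cube_bump_ge0.
have [|m] := compact_EVT_min (f := g) K0 cK.
  by apply: continuous_subspaceT => x; exact: C1pt_continuous.
move=> /set_mem Km gm; have m0 := gK _ Km.
pose L := \bigcup_(c in [set` D]) closed_ball_ Num.norm c (rho c).
(* The profile [1 - sqpos (1 - s ^+ 2)] takes its values in [[0, 1]], is [0] at [s = 0] and [1] for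
   [s >= 1]; here [s] is [g] divided by its minimum on [K]. *)
exists (fun x => 1 - sqpos (1 - (g x / g m) ^+ 2)), L; split.
- move=> x; apply: C1ptB; first exact: C1pt_cst.
  apply: (@C1pt_comp _ _ sqpos); first exact: C1pt_sqpos.
  apply: C1ptB; first exact: C1pt_cst.
  by apply: C1ptX; apply: C1ptM => //; exact: C1pt_cst.
- move=> x; rewrite gerBl sqpos_ge0 andbT subr_ge0.
  rewrite /sqpos exprn_ile1 ?le_max ?lexx ?orbT//.
  by rewrite ge_max ler01 andbT gerBl sqr_ge0.
- move=> x Kx; rewrite sqpos_eq0 ?subr0// subr_le0 exprn_ege1//.
  by rewrite ler_pdivlMr// mul1r; apply/gm/mem_set.
- split; last first.
    by move=> x [c /= cD]; have [_] := rhoP _ (set_mem (DK _ cD)); apply.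
  rewrite /L bigcup_seq; apply: bigsetU_compact => c _.
  apply: (subclosed_compact _ (@compact_le_norm R n (`|c| + rho c))).
    exact: closed_closed_ball_.
  move=> x /= cx; rewrite -[x](subKr c) (le_trans (ler_normB _ _))//.
  by rewrite lerD2l.
- move=> x NLx.
  have -> : g x = 0.
    rewrite /g big_seq big1// => c cD; apply: cube_bump_eq0.
      by have [] := rhoP _ (set_mem (DK _ cD)).
    by move=> cx; apply: NLx; exists c.
  by rewrite mul0r expr0n subr0 /sqpos max_l// expr1n subrr.
Qed.
End Bump.

(** * Orthonormal frames *)

Section Frame.
Context {R : realType}.
Local Notation R3 := 'rV[R]_3.
Implicit Types u v : R3.

Lemma dotvE u v : dotv u v = u 0 0 * v 0 0 + u 0 1 * v 0 1 + u 0 2 * v 0 2.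
Proof.
rewrite /dotv !big_ord_recl big_ord0 addr0 addrA.
by congr (_ * _ + _ * _ + _ * _); congr (_ _ _); apply: val_inj.
Qed.

Lemma vec3_0 (a b c : R) : vec3 a b c 0 0 = a. Proof. by rewrite mxE. Qed.
Lemma vec3_1 (a b c : R) : vec3 a b c 0 1 = b. Proof. by rewrite mxE. Qed.
Lemma vec3_2 (a b c : R) : vec3 a b c 0 2 = c. Proof. by rewrite mxE. Qed.
Definition vec3E := (vec3_0, vec3_1, vec3_2).

Lemma C1pt_vec3 (V : normedModType R) (f0 f1 f2 : V -> R) x (j : 'I_3) :
  C1pt f0 x -> C1pt f1 x -> C1pt f2 x ->
  C1pt (fun y => vec3 (f0 y) (f1 y) (f2 y) 0 j) x.
Proof.
move=> C0 C1 C2.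
case: j => -[|[|[|//]]] ?;
  [move: C0|move: C1|move: C2]; congr (C1pt _ x);
  by apply/funext => y; rewrite mxE.
Qed.

Definition cross u v : R3 :=
  vec3 (u 0 1 * v 0 2 - u 0 2 * v 0 1) (u 0 2 * v 0 0 - u 0 0 * v 0 2)
       (u 0 0 * v 0 1 - u 0 1 * v 0 0).

Lemma dotvC u v : dotv u v = dotv v u.
Proof. by rewrite /dotv; apply: eq_bigr => i _; rewrite mulrC. Qed.

(** The middle vector has norm [1] by Lagrange's identity. The order [cross v u] makes the triple
    positively oriented. *)
Lemma orthonormal_basis_cross u v :
  dotv u u = 1 -> dotv v v = 1 -> dotv u v = 0 ->
  orthonormal_basis u (cross v u) v.
Proof.
move=> uu vv uv; set w := cross v u.
have uw : dotv u w = 0 by rewrite dotvE /w /cross !vec3E; ring.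
have vw : dotv v w = 0 by rewrite dotvE /w /cross !vec3E; ring.
have ww : dotv w w = 1.
  have -> : dotv w w = dotv v v * dotv u u - dotv u v ^+ 2.
    by rewrite !dotvE /w /cross !vec3E; ring.
  by rewrite uu vv uv; ring.
have dotX (i j : 'I_3) : dotv [:: u; w; v]`_i [:: u; w; v]`_j = (i == j)%:R.
  case: i => -[|[|[|//]]] ?; case: j => -[|[|[|//]]] ? /=;
  by rewrite ?uu ?vv ?ww ?uv ?uw ?vw
    ?(dotvC v u) ?(dotvC w u) ?(dotvC w v) ?uv ?uw ?vw.
split; first exact: dotX.
(* Three vectors in dimension 3 form a basis once they are free; pairing a vanishing combination
   with the [i]-th vector isolates its coefficient [k i]. *)
rewrite basisEfree subvf dimvf /= andbT.
apply/(@freeP _ _ _ (in_tuple [:: u; w; v])) => k k0 i.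
have : dotv (\sum_(j < 3) k j *: [:: u; w; v]`_j) [:: u; w; v]`_i = 0.
  by rewrite k0 /dotv big1// => j _; rewrite mxE mul0r.
have -> : dotv (\sum_(j < 3) k j *: [:: u; w; v]`_j) [:: u; w; v]`_i =
    \sum_(j < 3) k j * dotv [:: u; w; v]`_j [:: u; w; v]`_i.
  rewrite /dotv; under [LHS]eq_bigr do rewrite summxE mulr_suml.
  rewrite exchange_big /= ; apply: eq_bigr => j _; rewrite mulr_sumr.
  by apply: eq_bigr => l _; rewrite mxE mulrA.
rewrite (bigD1 i)//= dotX eqxx mulr1 big1 ?addr0// => j ji.
by rewrite dotX (negbTE ji) mulr0.
Qed.

(** This makes a function controlled only on [U] globally C^1: a point outside the closed set [L]
    has a neighbourhood where the product is [0], whatever the values of [f]. *)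
Lemma C1pt_cutoff (V : normedModType R) (U L : set V) (phi f : V -> R) :
  (forall x, C1pt phi x) -> closed L -> L `<=` U ->
  (forall x, ~ L x -> phi x = 0) ->
  (forall x, U x -> C1pt f x) -> forall x, C1pt (fun y => phi y * f y) x.
Proof.
move=> C1phi cL LU phi0 C1f x.
have [/LU Ux|NLx] := pselect (L x); first by apply: C1ptM => //; exact: C1f.
have : \forall y \near x, (~` L) y.
  by apply: open_nbhs_nbhs; split => //; exact: closed_openC.
move=> nL; apply: (C1pt_near_eq _ (C1pt_cst 0 x)).
by apply: filterS nL => y /phi0 ->; rewrite mul0r.
Qed.

Lemma bounded_closure n (A : set 'rV[R]_n) :
  bounded_set A -> bounded_set (closure A).
Proof.
move=> /ex_strict_bound_gt0[r r0 Ar]; apply: compact_bounded.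
apply: (subclosed_compact (@closed_closure _ A) (@compact_le_norm R n r)).
have cB : closed [set x : 'rV[R]_n | `|x| <= r].
  exact: (compact_closed (@norm_hausdorff _ _) (@compact_le_norm R n r)).
rewrite closureE; apply: smallest_sub; first exact: cB.
by move=> x /Ar /ltW.
Qed.

End Frame.

End LipschitzFrame.

(** * Construction of the frame and of its directed extension *)

Theorem mainTheorem4 (R : realType) (Omega U : set 'rV[R]_3)
    (b : 'rV[R]_3 -> 'rV[R]_3) :
  is_domain Omega -> bounded_set Omega -> lipschitz_boundary Omega ->
  open U -> U `&` z_axis = set0 -> closure Omega `<=` U ->
  C1_on U b ->
  (forall x, U x -> enorm (b x) = 1) ->
  (forall x, U x -> 0 < dotv (b x) (e_theta x)) ->
  exists b1 b2 b3 : 'rV[R]_3 -> 'rV[R]_3,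
    [/\ [/\ [lipschitz b1 x | x in Omega], [lipschitz b2 x | x in Omega]
          & [lipschitz b3 x | x in Omega]],
        (forall x, Omega x -> b1 x = b x),
        (forall x, Omega x -> orthonormal_basis (b1 x) (b2 x) (b3 x))
      & exists B3 : 'rV[R]_3 -> 'rV[R]_3,
        [/\ (forall x, Omega x -> B3 x = b3 x),
            C1_on setT B3,
            bounded_fun (jacobian B3)
          & globally_directed B3]].
Proof.
move=> [_ _ [x0 Ox0]] bO _ oU _ OU C1b b1 btheta.
have cK : compact (closure Omega).
  apply: bounded_closed_compact; first exact: bounded_closure.
  exact: closed_closure.
have K0 : closure Omega !=set0 by exists x0; exact: subset_closure.
have [phi [L [C1phi phi01 phiK [cL LU] phi0]]] := C1_bump cK K0 oU OU.
have clL : closed L by exact: (compact_closed (@norm_hausdorff _ _) cL).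
have phiO x : Omega x -> phi x = 1 by move=> Ox; exact/phiK/subset_closure.
have LK x : Omega x -> L x.
  move=> Ox; apply: contrapT => /phi0; rewrite phiO// => /eqP.
  by rewrite oner_eq0.
have bb x : U x -> dotv (b x) (b x) = 1.
  move=> Ux; have := b1 x Ux; rewrite /enorm => e1.
  have d0 : 0 <= dotv (b x) (b x).
    by apply: sumr_ge0 => i _; rewrite -expr2 sqr_ge0.
  by rewrite -[LHS]sqr_sqrtr// e1 expr1n.
(* For unit [b], this is the squared norm of [e_z - (b . e_z) b], the projection of [e_z] on the
   plane orthogonal to [b]; [p] below is the factor normalizing that projection. *)
pose q x := 1 - b x 0 2 ^+ 2.
have q0 x : U x -> 0 < q x.
  (* Here [q] is the squared norm of the horizontal part of [b]. As [e_theta] is horizontal,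
     [b . e_theta] would vanish with that part. *)
  move=> Ux; have := bb x Ux; have := btheta x Ux.
  rewrite !dotvE /e_theta !vec3E mulr0 addr0 -!expr2 /q => bt <-.
  rewrite addrK lt_neqAle addr_ge0 ?sqr_ge0// andbT eq_sym.
  apply/eqP => /eqP; rewrite paddr_eq0 ?sqr_ge0// !sqrf_eq0.
  move=> /andP[/eqP h0 /eqP h1].
  by move: bt; rewrite h0 h1 !mul0r addr0 ltxx.
pose p x := (Num.sqrt (q x))^-1.
have pq x : U x -> p x ^+ 2 * q x = 1.
  move=> Ux; rewrite /p exprVn sqr_sqrtr ?(ltW (q0 x Ux))//.
  by rewrite mulVf// gt_eqF// q0.
have C1bj x j : U x -> C1pt (fun y => b y 0 j) x by exact: C1_on_coord.
have C1q x : U x -> C1pt q x.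
  by move=> Ux; apply: C1ptB; [exact: C1pt_cst|apply: C1ptX; exact: C1bj].
have C1p x : U x -> C1pt p x.
  move=> Ux.
  apply: (@C1pt_comp _ _ (fun t => (Num.sqrt t)^-1)); last exact: C1q.
  by apply: C1pt_invsqrt; exact: q0.
have cutoff f := @C1pt_cutoff _ _ U L phi f C1phi clL LU phi0.
pose B1 x := vec3 (phi x * b x 0 0) (phi x * b x 0 1) (phi x * b x 0 2).
(* The factors of [phi x] are the coordinates of [n = p (e_z - (b . e_z) b)]; the vertical one is
   [p (1 - (b . e_z)^2) = q p]. *)
pose B3 x := vec3 (phi x * - (b x 0 0 * b x 0 2 * p x))
  (phi x * - (b x 0 1 * b x 0 2 * p x)) (phi x * (q x * p x) + (1 - phi x)).
have C1B1 x j : C1pt (fun y => B1 y 0 j) x.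
  by apply: C1pt_vec3; apply: cutoff => y Uy; exact: C1bj.
have C1B3 x j : C1pt (fun y => B3 y 0 j) x.
  apply: C1pt_vec3.
  - apply: cutoff => y Uy; apply: C1ptN; apply: C1ptM; last exact: C1p.
    by apply: C1ptM; exact: C1bj.
  - apply: cutoff => y Uy; apply: C1ptN; apply: C1ptM; last exact: C1p.
    by apply: C1ptM; exact: C1bj.
  - apply: C1ptD; last by apply: C1ptB => //; exact: C1pt_cst.
    by apply: cutoff => y Uy; apply: C1ptM; [exact: C1q|exact: C1p].
have C1B2 x j : C1pt (fun y => cross (B3 y) (B1 y) 0 j) x.
  by apply: C1pt_vec3; apply: C1ptB; apply: C1ptM.
have B1O x : Omega x -> B1 x = b x.
  move=> Ox; rewrite /B1 phiO// !mul1r; apply/rowP => i; rewrite mxE.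
  by case: i => -[|[|[|//]]] ? /=; congr (b x _ _); apply: val_inj.
exists B1, (fun x => cross (B3 x) (B1 x)), B3; split.
- by split; apply: C1pt_row_lipschitz.
- exact: B1O.
- move=> x Ox; have Ux : U x by exact/LU/LK.
  have bx := bb x Ux; have pqx := pq x Ux.
  apply: orthonormal_basis_cross.
  + by rewrite B1O.
  + rewrite dotvE /B3 !vec3E phiO// subrr addr0 !mul1r.
    move: bx; rewrite dotvE => bx.
    have bxE : b x 0 0 * b x 0 0 + b x 0 1 * b x 0 1 = q x.
      by rewrite /q -bx; ring.
    (* The horizontal part of [b] has squared norm [q], so the squared norm of [n] factors as
       [p^2 q] times [b_z^2 + q], and both factors are [1]. *)
    transitivity (p x ^+ 2 *
      ((b x 0 0 * b x 0 0 + b x 0 1 * b x 0 1) * b x 0 2 ^+ 2 + q x ^+ 2)).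
      by ring.
    rewrite bxE.
    transitivity (p x ^+ 2 * q x * (b x 0 2 ^+ 2 + q x)); first by ring.
    by rewrite pqx /q; ring.
  + rewrite B1O// dotvE /B3 !vec3E phiO// subrr addr0 !mul1r.
    move: bx; rewrite dotvE => bx.
    (* The scalar product [b . n] is a multiple of [1 - |b|^2], which is [0]. *)
    transitivity (p x * b x 0 2 *
      (1 - (b x 0 0 * b x 0 0 + b x 0 1 * b x 0 1 + b x 0 2 * b x 0 2))).
      by rewrite /q; ring.
    by rewrite bx subrr mulr0.
exists B3; split.
- by [].
- by move=> x _; exact: C1pt_row.
(* Off [L] the cutoff vanishes and [B3] is the constant [e_z]. *)
- apply: (@bounded_jacobian _ _ _ B3 L (vec3 0 0 1)) => // x NLx.
  by rewrite /B3 phi0// !mul0r subr0 add0r.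
(* The direction is [e_z]. On [L] the vertical component of [B3] is a convex combination of [q p]
   and [1], and [q p] has a positive minimum there by compactness; off [L] it equals [1]. Hence the
   constant [min (q m * p m) 1]. *)
- have L0 : L !=set0 by exists x0; exact: LK.
  have [|m /set_mem Lm qpm] := compact_EVT_min (f := fun x => q x * p x) L0 cL.
    apply: continuous_in_subspaceT => x /set_mem Lx; apply: C1pt_continuous.
    by apply: C1ptM; [exact/C1q/LU|exact/C1p/LU].
  have qp0 : 0 < q m * p m.
    by rewrite mulr_gt0 ?q0 ?invr_gt0 ?sqrtr_gt0 ?q0//; exact: LU.
  exists (vec3 0 0 1); split.
    by rewrite /enorm dotvE !vec3E !mulr0 !add0r mulr1 sqrtr1.
  exists (Num.min (q m * p m) 1); first by rewrite lt_min qp0 ltr01.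
  move=> x; rewrite dotvE !vec3E !mulr0 !add0r mulr1.
  have [Lx|NLx] := pselect (L x); last first.
    by rewrite phi0// mul0r subr0 add0r ge_min lexx orbT.
  have /andP[f0 f1] := phi01 x.
  have h1 : Num.min (q m * p m) 1 <= q x * p x.
    by rewrite ge_min qpm ?orbT//; exact: mem_set.
  have h2 : Num.min (q m * p m) 1 <= 1 by rewrite ge_min lexx orbT.
  move: h1 h2; set a := Num.min _ _ => h1 h2; nra.
Qed.
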